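(* Let $\varepsilon>0$, $\kappa\ge\frac14$, $\Delta t>0$, $C_4=\frac{1}{1-e^{-2}}$, $\gamma^{(0)}=3C_4(1+\kappa)$, $\gamma_1^{(0)}=\frac32C_4(1+\kappa)$, $\gamma_3^{(0)}=\frac12C_4(1+\kappa)$, $\alpha_0=\ln\Big(\frac{\gamma^{(0)}+\frac12\kappa}{\gamma^{(0)}-\frac12\kappa}\Big)$, and suppose $A\ge(\gamma^{(0)}-\frac{\kappa}{4})^4\alpha_0^{-2}\varepsilon^{-2}$. Let $u^{-2},u^{-1},u^0$ be real periodic grid functions with equal means, and let $u^{n+1}$, $n\ge0$, be defined by the scheme $$u^{n+1}=e^{-\Delta tL_N}u^n-A\Delta t^3\phi_0(L_N)\Delta_N^2(u^{n+1}-u^n)-\Delta t\,\phi_0(L_N)f_N(u^n)-\Delta t\,\phi_1(L_N)\Big(\tfrac32f_N(u^n)-2f_N(u^{n-1})+\tfrac12f_N(u^{n-2})\Big)-\Delta t\,\phi_2(L_N)\Big(\tfrac12f_N(u^n)-f_N(u^{n-1})+\tfrac12f_N(u^{n-2})\Big).$$ Define the modified energy $$\tilde E_N(u^{n+1},u^n,u^{n-1})=E_N(u^{n+1})+\gamma_1^{(0)}\|\nabla_N(u^{n+1}-u^n)\|_2^2+\gamma_3^{(0)}\|\nabla_N(u^n-u^{n-1})\|_2^2.$$ Then for every $n\ge0$, $$\tilde E_N(u^{n+1},u^n,u^{n-1})\le \tilde E_N(u^n,u^{n-1},u^{n-2}).$$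
   Context: Setting: $\Omega=(0,1)^2$, $N=2K+1$, $h=1/N$, grid $x_i=ih$, $y_j=jh$; periodic grid functions have discrete Fourier expansions $f_{i,j}=\sum_{k,\ell=-K}^{K}\hat f_{k,\ell}\exp(2\pi\mathrm{i}(kx_i+\ell y_j))$. Spectral operators act as Fourier multipliers: $\mathcal D_{Nx}$, $\mathcal D_{Ny}$ by $2\pi\mathrm{i}k$, $2\pi\mathrm{i}\ell$; $\nabla_N f=(\mathcal D_{Nx}f,\mathcal D_{Ny}f)$, $\nabla_N\cdot(f_1,f_2)=\mathcal D_{Nx}f_1+\mathcal D_{Ny}f_2$, $\Delta_N$ has multiplier $-\lambda_{k,\ell}$, $\lambda_{k,\ell}=(2k\pi)^2+(2\ell\pi)^2$. Inner product $\langle f,g\rangle=h^2\sum_{i,j}f_{i,j}g_{i,j}$, $\|f\|_2=\langle f,f\rangle^{1/2}$. $L_N=\varepsilon^2\Delta_N^2-\kappa\Delta_N$ with multiplier $\Lambda_{k,\ell}=\varepsilon^2\lambda_{k,\ell}^2+\kappa\lambda_{k,\ell}$; $e^{-\Delta tL_N}$ has multiplier $e^{-\Delta t\Lambda_{k,\ell}}$. With $g_0(x)=\frac{1-e^{-x}}{x}$, $g_1(x)=\frac{1-g_0(x)}{x}$, $g_2(x)=\frac{1-2g_1(x)}{x}$: $\phi_0(L_N)=(\Delta tL_N)^{-1}(I-e^{-\Delta tL_N})$, $\phi_1(L_N)=(\Delta tL_N)^{-1}(I-(\Delta tL_N)^{-1}(I-e^{-\Delta tL_N}))$, $\phi_2(L_N)=(\Delta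 tL_N)^{-1}(I-2(\Delta tL_N)^{-1}(I-(\Delta tL_N)^{-1}(I-e^{-\Delta tL_N})))$, i.e. the multipliers $g_j(\Delta t\Lambda_{k,\ell})$, $j=0,1,2$, on nonzero modes (they are applied only to zero-mean grid functions). Nonlinearity (pointwise): $f_N(u)=\nabla_N\cdot\Big(\frac{\nabla_N u}{1+|\nabla_N u|^2}\Big)+\kappa\Delta_N u$. Discrete energy: $E_N(\phi)=h^2\sum_{i,j}\big(-\frac12\ln(1+|\nabla_N\phi|^2)_{i,j}\big)+\frac{\varepsilon^2}{2}\|\Delta_N\phi\|_2^2$. *)

(* Defs.v *)
From HB Require Import structures.
From mathcomp Require Import all_boot all_order all_algebra.
From mathcomp Require Import all_classical all_reals all_analysis.
Set Implicit Arguments. Unset Strict Implicit. Unset Printing Implicit Defensive.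
Import Order.TTheory GRing.Theory Num.Theory.
Local Open Scope ring_scope.

Section Spectral.
Variables (R : realType) (K : nat).

Definition NN : nat := (2 * K + 1)%N.
Definition hh : R := 1 / (NN%:R).

Definition grid := 'I_NN -> 'I_NN -> R.

Definition xc (i : 'I_NN) : R := (i%:R) * hh.
Definition freq (k : 'I_NN) : R := (k%:R) - (K%:R).

(* Fourier multiplier with (Hermitian) symbol m(k,l) = a(k,l) + i b(k,l),
   applied to a real grid function f:
   (M f)_{p,q} = sum_{k,l} m(k,l) hat f_{k,l} exp(2 pi i (k x_p + l y_q)),
   hat f_{k,l} = N^{-2} sum_{i,j} f_{i,j} exp(-2 pi i (k x_i + l y_j)).
   For Hermitian symbols the result is real and equals its real part,
   which is what is written below. *)
Definition fmult (a b : R -> R -> R) (f : grid) : grid :=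
  fun p q =>
    (1 / (NN%:R ^+ 2)) *
    \sum_(i < NN) \sum_(j < NN) f i j *
      \sum_(k < NN) \sum_(l < NN)
        (a (freq k) (freq l) *
           cos (2 * pi * (freq k * (xc p - xc i) + freq l * (xc q - xc j)))
         - b (freq k) (freq l) *
           sin (2 * pi * (freq k * (xc p - xc i) + freq l * (xc q - xc j)))).

Definition lam (k l : R) : R := (2 * k * pi) ^+ 2 + (2 * l * pi) ^+ 2.

Definition DNx (f : grid) : grid := fmult (fun _ _ => 0) (fun k _ => 2 * pi * k) f.
Definition DNy (f : grid) : grid := fmult (fun _ _ => 0) (fun _ l => 2 * pi * l) f.
Definition LapN (f : grid) : grid := fmult (fun k l => - lam k l) (fun _ _ => 0) f.
Definition divN (f1 f2 : grid) : grid := fun i j => DNx f1 i j + DNy f2 i j.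

Definition inner (f g : grid) : R := hh ^+ 2 * \sum_(i < NN) \sum_(j < NN) f i j * g i j.
Definition nrm2sq (f : grid) : R := inner f f.
Definition gradsq (f : grid) : R := nrm2sq (DNx f) + nrm2sq (DNy f).
Definition mean (f : grid) : R := hh ^+ 2 * \sum_(i < NN) \sum_(j < NN) f i j.

Variables (eps kappa dt : R).

(* L_N = eps^2 Delta_N^2 - kappa Delta_N : multiplier Lambda *)
Definition Lam (k l : R) : R := eps ^+ 2 * (lam k l) ^+ 2 + kappa * lam k l.

Definition g0 (x : R) : R := (1 - expR (- x)) / x.
Definition g1 (x : R) : R := (1 - g0 x) / x.
Definition g2 (x : R) : R := (1 - 2 * g1 x) / x.

Definition expL (f : grid) : grid := fmult (fun k l => expR (- (dt * Lam k l))) (fun _ _ => 0) f.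
(* phi_j(L_N): multiplier g_j(dt Lambda); only applied to zero-mean functions,
   so the (unspecified) value at the zero mode is irrelevant. *)
Definition phi0 (f : grid) : grid := fmult (fun k l => g0 (dt * Lam k l)) (fun _ _ => 0) f.
Definition phi1 (f : grid) : grid := fmult (fun k l => g1 (dt * Lam k l)) (fun _ _ => 0) f.
Definition phi2 (f : grid) : grid := fmult (fun k l => g2 (dt * Lam k l)) (fun _ _ => 0) f.

Definition fN (u : grid) : grid :=
  fun i j =>
    divN (fun p q => DNx u p q / (1 + (DNx u p q ^+ 2 + DNy u p q ^+ 2)))
         (fun p q => DNy u p q / (1 + (DNx u p q ^+ 2 + DNy u p q ^+ 2))) i j
    + kappa * LapN u i j.

Definition EN (phi : grid) : R :=
  hh ^+ 2 * \sum_(i < NN) \sum_(j < NN)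
     (- (1/2) * ln (1 + (DNx phi i j ^+ 2 + DNy phi i j ^+ 2)))
  + eps ^+ 2 / 2 * nrm2sq (LapN phi).

Definition C4 : R := 1 / (1 - expR (-2)).
Definition gam0 : R := 3 * C4 * (1 + kappa).
Definition gam1 : R := 3 / 2 * C4 * (1 + kappa).
Definition gam3 : R := 1 / 2 * C4 * (1 + kappa).
Definition alpha0 : R := ln ((gam0 + 1/2 * kappa) / (gam0 - 1/2 * kappa)).

Definition Etilde (v2 v1 v0 : grid) : R :=
  EN v2 + gam1 * gradsq (fun i j => v2 i j - v1 i j)
        + gam3 * gradsq (fun i j => v1 i j - v0 i j).

Definition scheme_rhs (A : R) (unp1 un unm1 unm2 : grid) : grid :=
  fun i j =>
    expL un i j
    - A * dt ^+ 3 * phi0 (LapN (LapN (fun p q => unp1 p q - un p q))) i j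
    - dt * phi0 (fN un) i j
    - dt * phi1 (fun p q => 3/2 * fN un p q - 2 * fN unm1 p q + 1/2 * fN unm2 p q) i j
    - dt * phi2 (fun p q => 1/2 * fN un p q - fN unm1 p q + 1/2 * fN unm2 p q) i j.

End Spectral.

(* Main.v *)
Require Import Defs.
From HB Require Import structures.
From mathcomp Require Import all_boot all_order all_algebra.
From mathcomp Require Import all_classical all_reals all_analysis.
From mathcomp Require Import ring lra.
Import Order.TTheory GRing.Theory Num.Theory.
Local Open Scope ring_scope.

(** Write w = u^(n+1) - u^n and C = 1 + kappa.  On a mode with l = lambda > 0,
    L = Lambda, E = exp(-dt L), dividing the scheme by dt g0(dt L) gives
      f(u^n) + L u^n = - (L / (1 - E) + A dt^2 l^2) w - r1 D1 + r2 D2,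
    where D1, D2 are the last two increments of f, and 0 <= r1 <= 2, 0 <= r2 <= 1
    because 0 <= g1, g2 <= g0.  Tested against w, the left side bounds the energy
    increment up to (kappa/4) |grad w|^2 + (eps^2/2) |Lap w|^2, since the Hessian of
    -ln(1+|p|^2)/2 is at most 1/8 and kappa >= 1/4.  As f is the divergence of a
    C-Lipschitz function of the gradient, Young's inequality splits the D1, D2 terms
    into squared gradients of increments, which telescope in the modified energy.
    What remains is the scalar inequality
      (gam0 + kappa/4) l + eps^2 l^2 / 2 <= L / (1 - E) + A dt^2 l^2,
    supplied by the exponential integrator when dt L <= alpha0, and by the
    stabilization A otherwise. *)

(** * Scalar inequalities *)

Lemma expRN_le_inv1D (R : realType) (x : R) : (1 + x) * expR (- x) <= 1.
Proof.
have e0 := expR_gt0 (- x).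
rewrite -[leRHS](expRxMexpNx_1 x) ler_pM2r //; exact: expR_ge1Dx.
Qed.

Lemma ge0_is_derive_ndecr (R : realType) (f df : R -> R) (a x : R) :
  (forall y : R, is_derive y 1 f (df y)) -> (forall y, a <= y -> 0 <= df y) ->
  a <= x -> f a <= f x.
Proof.
move=> fdf df0 ax.
apply: (@ger0_derive1_ndecry R f a) => // [y|].
- rewrite in_itv /= andbT => ay.
  have -> : derive1 f y = df y by rewrite derive1E; exact: derive_val.
  by rewrite df0 ?ltW.
- by apply: derivable_within_continuous => y _; exact: ex_derive.
Qed.

Lemma expR_ge_quadratic (R : realType) (x : R) : 0 <= x ->
  1 + x + x ^+ 2 / 2 <= expR x.
Proof.
pose f (y : R) : R := expR y - (1 + y + y ^+ 2 / 2).
have df (y : R) : is_derive y 1 f (expR y - (1 + y)).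
  by rewrite /f; apply: is_derive_eq; rewrite /GRing.scale /=; field.
move=> x0; have := ge0_is_derive_ndecr R f _ 0 x df.
rewrite /f expR0 => H; have : 1 - (1 + 0 + 0 ^+ 2 / 2) <= expR x - (1 + x + x ^+ 2 / 2).
  by apply: H => // y _; rewrite subr_ge0 expR_ge1Dx.
lra.
Qed.

(** This is [g2 x <= g0 x] with denominators cleared and multiplied by exp(x). The gap between the
    two sides vanishes at 0 and has derivative 2y(exp(y) - 1). *)
Lemma sqr_sub2_le_expR (R : realType) (x : R) : 0 <= x ->
  x ^+ 2 - 2 <= 2 * (x - 1) * expR x.
Proof.
pose f (y : R) : R := 2 * (y - 1) * expR y - (y ^+ 2 - 2).
have df (y : R) : is_derive y 1 f (2 * y * (expR y - 1)).
  by rewrite /f; apply: is_derive_eq; rewrite /GRing.scale /=; ring.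
move=> x0; have := ge0_is_derive_ndecr R f _ 0 x df.
rewrite /f expR0 => H.
have : 2 * (0 - 1) * 1 - (0 ^+ 2 - 2) <= 2 * (x - 1) * expR x - (x ^+ 2 - 2).
  apply: H => // y y0; rewrite mulr_ge0 ?mulr_ge0 // subr_ge0.
  by have := expR_ge1Dx y; lra.
lra.
Qed.

Lemma g0_gt0 (R : realType) (x : R) : 0 < x -> 0 < g0 x.
Proof. by move=> x0; rewrite /g0 divr_gt0 // subr_gt0 expR_lt1 oppr_lt0. Qed.

Lemma g1_ge0 (R : realType) (x : R) : 0 < x -> 0 <= g1 x.
Proof.
move=> x0; rewrite /g1 /g0; apply: divr_ge0; last exact: ltW.
rewrite subr_ge0 ltW // ltr_pdivrMr // mul1r.
have := @expR_gt1Dx R (- x); rewrite oppr_eq0 gt_eqF // => /(_ isT); lra.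
Qed.

Lemma g1_le_g0 (R : realType) (x : R) : 0 < x -> g1 x <= g0 x.
Proof.
move=> x0; rewrite /g1 /g0 ler_pM2r ?invr_gt0 //.
rewrite lerBlDr -lerBlDl ler_pdivlMr //.
have := expRN_le_inv1D R x; lra.
Qed.

Lemma g2_ge0 (R : realType) (x : R) : 0 < x -> 0 <= g2 x.
Proof.
move=> x0; have e0 := expR_gt0 (- x).
have e1 := expRxMexpNx_1 x.
have e2 := expR_ge_quadratic R x (ltW x0).
rewrite /g2; apply: divr_ge0; last exact: ltW.
rewrite subr_ge0 /g1 /g0.
have -> : 2 * ((1 - (1 - expR (- x)) / x) / x) = 2 * (x - 1 + expR (- x)) / x ^+ 2.
  by field; rewrite gt_eqF.
rewrite ler_pdivrMr ?exprn_gt0 // mul1r.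
have : expR (- x) * (1 + x + x ^+ 2 / 2) <= 1.
  by rewrite -[leRHS]e1 mulrC ler_pM2r.
set p := 1 + x + _ => ep; have p0 : 0 < p by rewrite /p; nra.
(* The numerator of [g2] asks for this bound. As exp(-x) p <= 1, it is enough that (1 - x + x^2/2) p
   = 1 + x^4/4 is at least 1. *)
suff : expR (- x) <= 1 - x + x ^+ 2 / 2 by lra.
rewrite -(ler_pM2r p0) (le_trans ep) //.
have -> : (1 - x + x ^+ 2 / 2) * p = 1 + (x ^+ 2 / 2) ^+ 2 by rewrite /p; field.
by rewrite lerDl sqr_ge0.
Qed.

Lemma g2_le_g0 (R : realType) (x : R) : 0 < x -> g2 x <= g0 x.
Proof.
move=> x0; have e0 := expR_gt0 (- x).
have e1 := expRxMexpNx_1 x.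
have e2 := sqr_sub2_le_expR R x (ltW x0).
rewrite /g2 /g1 /g0 ler_pM2r ?invr_gt0 //.
have -> : 2 * ((1 - (1 - expR (- x)) / x) / x) = 2 * (x - 1 + expR (- x)) / x ^+ 2.
  by field; rewrite gt_eqF.
rewrite lerBlDr -lerBlDl ler_pdivlMr ?exprn_gt0 //.
have : (x ^+ 2 - 2) * expR (- x) <= 2 * (x - 1).
  by rewrite -[leRHS]mulr1 -[X in _ <= _ * X]e1 mulrA ler_pM2r.
lra.
Qed.

(* This is t/2 + 1/t^3 >= 1 for t = z/M. *)
Lemma half_add_inv_cube_ge (R : realFieldType) (M z : R) : 0 < M -> 0 < z ->
  M <= z / 2 + M ^+ 4 / z ^+ 3.
Proof.
move=> M0 z0.
rewrite -subr_ge0.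
have -> : z / 2 + M ^+ 4 / z ^+ 3 - M = (z ^+ 4 - 2 * M * z ^+ 3 + 2 * M ^+ 4) / (2 * z ^+ 3).
  by field; rewrite gt_eqF.
apply: divr_ge0; last by rewrite mulr_ge0 ?exprn_ge0 // ltW.
have -> : z ^+ 4 - 2 * M * z ^+ 3 + 2 * M ^+ 4 = (z ^+ 2 - M * z - M ^+ 2) ^+ 2 + M ^+ 2 * (z - M) ^+ 2.
  ring.
by rewrite addr_ge0 ?sqr_ge0 // mulr_ge0 ?sqr_ge0.
Qed.

(** The two regimes meet at dt L = a: below it exp(-dt L) is bounded away from 0 and L / (1 - E)
    suffices; above it dt > a / L makes the stabilization term large. *)
Lemma stabilized_mode_bound (R : realType) (eps kappa dt A M g a l L : R) :
  0 < eps -> 0 < kappa -> 0 < dt -> 0 < l -> kappa / 2 < g -> M = g - kappa / 4 ->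
  a = ln ((g + 1/2 * kappa) / (g - 1/2 * kappa)) ->
  M ^+ 4 * a ^- 2 * eps ^- 2 <= A ->
  L = eps ^+ 2 * l ^+ 2 + kappa * l ->
  (g + kappa / 4) * l + eps ^+ 2 / 2 * l ^+ 2
    <= L / (1 - expR (- (dt * L))) + A * dt ^+ 2 * l ^+ 2.
Proof.
move=> eps0 k0 dt0 l0 gk MM aE HA LE.
have L0 : 0 < L by rewrite LE addr_gt0 // mulr_gt0 ?exprn_gt0.
have kL : kappa * l <= L by rewrite LE lerDr mulr_ge0 ?exprn_ge0 // ltW.
have x0 : 0 < dt * L by rewrite mulr_gt0.
set E := expR _.
have E1 : E < 1 by rewrite expR_lt1 oppr_lt0.
have E0 : 0 < E by rewrite expR_gt0.
have E1' : 0 < 1 - E by lra.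
have q0 : 0 < (g + 1/2 * kappa) / (g - 1/2 * kappa) by rewrite divr_gt0 //; lra.
have a0 : 0 < a by rewrite aE ln_gt0 // ltr_pdivlMr; lra.
have A0 : 0 <= A.
  by apply: le_trans HA; rewrite MM !mulr_ge0 ?invr_ge0 ?exprn_ge0 //; lra.
have [xa|ax] := leP (dt * L) a.
(* The value of a is chosen so that exp(-a) = (g - kappa/2) / (g + kappa/2). With kappa l <= L, this
   is what g l (1 - E) <= L (1 + E) / 2 requires. *)
- have EE : (g - 1/2 * kappa) <= E * (g + 1/2 * kappa).
    have : expR (- a) <= E by rewrite ler_expR lerN2.
    rewrite aE expRN lnK // invf_div ler_pdivrMr //; lra.
  have H : g * l + L / 2 <= L / (1 - E).
    rewrite ler_pdivlMr //.
    have : kappa * l * (1 + E) <= L * (1 + E) by rewrite ler_pM2r //; lra.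
    have : l * (g - 1/2 * kappa) <= l * (E * (g + 1/2 * kappa)) by rewrite ler_pM2l.
    lra.
  have : 0 <= A * dt ^+ 2 * l ^+ 2 by rewrite !mulr_ge0 ?exprn_ge0 // ltW.
  have kl : 0 < kappa * l by rewrite mulr_gt0.
  lra.
- have H : L <= L / (1 - E).
    rewrite ler_pdivlMr // ler_piMr //; lra.
  (* After division by l the goal reads M + z/2 <= z + A dt^2 l. Since dt z l > a, the hypothesis on
     A gives A dt^2 l >= M^4 / (z^2 eps^2 l) >= M^4 / z^3. *)
  set z := eps ^+ 2 * l + kappa.
  have Lz : L = l * z by rewrite LE /z; ring.
  have z0 : 0 < z by rewrite addr_gt0 // mulr_gt0 // exprn_gt0.
  have zk : eps ^+ 2 * l <= z by rewrite lerDl ltW.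
  have M0 : 0 < M by lra.
  have H1 := half_add_inv_cube_ge _ M z M0 z0.
  have H2 : M ^+ 4 / z ^+ 3 <= A * dt ^+ 2 * l.
    apply: le_trans (_ : M ^+ 4 * a ^- 2 * eps ^- 2 * dt ^+ 2 * l <= _); last first.
      by rewrite !ler_pM2r ?exprn_gt0.
    have -> : M ^+ 4 * a ^- 2 * eps ^- 2 * dt ^+ 2 * l
       = M ^+ 4 * ((dt * L) ^+ 2 / a ^+ 2) / (z ^+ 2 * (eps ^+ 2 * l)).
      by rewrite Lz; field; rewrite !gt_eqF //= !andbT !gt_eqF.
    rewrite -mulrA ler_pM2l ?exprn_gt0 //.
    apply: le_trans (_ : 1 / (z ^+ 2 * (eps ^+ 2 * l)) <= _); last first.
      rewrite ler_pM2r ?invr_gt0 ?mulr_gt0 ?exprn_gt0 // ler_pdivlMr ?exprn_gt0 //.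
      by rewrite mul1r lerXn2r ?nnegrE ?ltW.
    rewrite div1r lef_pV2 ?posrE ?mulr_gt0 ?exprn_gt0 //.
    by rewrite [z ^+ 3]exprSr ler_pM2l // exprn_gt0.
  have H3 : (g + kappa / 4) * l + eps ^+ 2 / 2 * l ^+ 2 <= L + A * dt ^+ 2 * l ^+ 2.
    have -> : L + A * dt ^+ 2 * l ^+ 2 = l * (z + A * dt ^+ 2 * l) by rewrite Lz; ring.
    have -> : (g + kappa / 4) * l + eps ^+ 2 / 2 * l ^+ 2 = l * (g + kappa / 4 + eps ^+ 2 * l / 2).
      by field.
    rewrite ler_pM2l //.
    have zE : z = eps ^+ 2 * l + kappa by [].
    lra.
  lra.
Qed.

Lemma C4_ge1 (R : realType) : 1 <= C4 R.
Proof.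
have e0 := @expR_gt0 R (- 2); have e1 : expR (- 2 : R) < 1 by rewrite expR_lt1; lra.
rewrite /C4 ler_pdivlMr; lra.
Qed.

(** * Bounds for the flux p / (1 + |p|^2) *)

(** With A = 1 + |a|^2 and B = 1 + |b|^2, the squared distance of the fluxes is exactly (|b - a|^2 A
    B - (|a|^2 - |b|^2)^2) / (A B)^2, and A B >= 1. *)
Lemma flux_lipschitz (R : realFieldType) (a1 a2 b1 b2 : R) :
  (b1 / (1 + (b1 ^+ 2 + b2 ^+ 2)) - a1 / (1 + (a1 ^+ 2 + a2 ^+ 2))) ^+ 2 + (b2 / (1 + (b1 ^+ 2 + b2 ^+ 2)) - a2 / (1 + (a1 ^+ 2 + a2 ^+ 2))) ^+ 2 <= (b1 - a1) ^+ 2 + (b2 - a2) ^+ 2.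
Proof.
set p := a1 ^+ 2 + a2 ^+ 2; set q := b1 ^+ 2 + b2 ^+ 2.
set A := 1 + p; set B := 1 + q.
have p0 : 0 <= p by rewrite addr_ge0 ?sqr_ge0.
have q0 : 0 <= q by rewrite addr_ge0 ?sqr_ge0.
have A1 : 1 <= A by rewrite lerDl.
have B1 : 1 <= B by rewrite lerDl.
have A0 : 0 < A by lra.
have B0 : 0 < B by lra.
set T := (b1 - a1) ^+ 2 + (b2 - a2) ^+ 2.
have T0 : 0 <= T by rewrite addr_ge0 ?sqr_ge0.
have -> : (b1 / B - a1 / A) ^+ 2 + (b2 / B - a2 / A) ^+ 2 =
   (T * (A * B) - (p - q) ^+ 2) / (A * B) ^+ 2.
  have -> : T * (A * B) - (p - q) ^+ 2 = (b1 * A - a1 * B) ^+ 2 + (b2 * A - a2 * B) ^+ 2.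
    rewrite /T /A /B /p /q; ring.
  by field; rewrite !gt_eqF.
have AB1 : 1 <= A * B by rewrite -[1]mulr1 ler_pM.
rewrite ler_pdivrMr ?exprn_gt0 ?mulr_gt0 //.
have : 0 <= (p - q) ^+ 2 by rewrite sqr_ge0.
have : T * (A * B) <= T * (A * B) ^+ 2.
  by rewrite ler_wpM2l // expr2 ler_peMr //; lra.
lra.
Qed.

(** The constant 1/8 is sharp: the radial derivative (1 - r^2) / (1 + r^2)^2 of the flux has minimum
    -1/8, at r^2 = 3. The proof is a sum-of-squares certificate, whose term (m - 3)^2 reflects this
    extremal radius. *)
Lemma flux_one_sided (R : realFieldType) (a1 a2 b1 b2 : R) :
  - (1/8) * ((b1 - a1) ^+ 2 + (b2 - a2) ^+ 2) <=
  (b1 / (1 + (b1 ^+ 2 + b2 ^+ 2)) - a1 / (1 + (a1 ^+ 2 + a2 ^+ 2))) * (b1 - a1) + (b2 / (1 + (b1 ^+ 2 + b2 ^+ 2)) - a2 / (1 + (a1 ^+ 2 + a2 ^+ 2))) * (b2 - a2).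
Proof.
set p := a1 ^+ 2 + a2 ^+ 2; set q := b1 ^+ 2 + b2 ^+ 2.
set A := 1 + p; set B := 1 + q.
have p0 : 0 <= p by rewrite addr_ge0 ?sqr_ge0.
have q0 : 0 <= q by rewrite addr_ge0 ?sqr_ge0.
have A0 : 0 < A by rewrite ltr_wpDr.
have B0 : 0 < B by rewrite ltr_wpDr.
set m := a1 * b1 + a2 * b2.
set T := (b1 - a1) ^+ 2 + (b2 - a2) ^+ 2.
have T0 : 0 <= T by rewrite addr_ge0 ?sqr_ge0.
rewrite -subr_ge0.
have -> : (b1 / B - a1 / A) * (b1 - a1) + (b2 / B - a2 / A) * (b2 - a2) - - (1/8) * T
  = (T * (m - 3) ^+ 2 + T ^+ 2 + (16 + T) * (a1 * b2 - a2 * b1) ^+ 2) / (8 * (A * B)).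
  have -> : T * (m - 3) ^+ 2 + T ^+ 2 + (16 + T) * (a1 * b2 - a2 * b1) ^+ 2
      = 8 * ((b1 * A - a1 * B) * (b1 - a1) + (b2 * A - a2 * B) * (b2 - a2)) + T * (A * B).
    rewrite /T /A /B /m /p /q; ring.
  by field; rewrite !gt_eqF.
apply: divr_ge0; last by rewrite !mulr_ge0 // ltW.
by rewrite !addr_ge0 // ?sqr_ge0 // mulr_ge0 ?sqr_ge0 // addr_ge0.
Qed.

Lemma log_potential_taylor (R : realType) (a1 a2 b1 b2 : R) :
  - (1/2) * ln (1 + (b1 ^+ 2 + b2 ^+ 2)) - - (1/2) * ln (1 + (a1 ^+ 2 + a2 ^+ 2))
  <= - (a1 / (1 + (a1 ^+ 2 + a2 ^+ 2)) * (b1 - a1) + a2 / (1 + (a1 ^+ 2 + a2 ^+ 2)) * (b2 - a2))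
     + 1/16 * ((b1 - a1) ^+ 2 + (b2 - a2) ^+ 2).
Proof.
set d1 := b1 - a1; set d2 := b2 - a2.
pose N (t : R) : R := 1 + ((a1 + t * d1) ^+ 2 + (a2 + t * d2) ^+ 2).
have N0 t : 0 < N t by rewrite ltr_wpDr // addr_ge0 ?sqr_ge0.
pose S := a1 / N 0 * d1 + a2 / N 0 * d2.
(* Along the segment from a to b, f 1 - f 0 is the right side of the claim minus its left side. *)
pose f (t : R) : R := t ^+ 2 / 16 * (d1 ^+ 2 + d2 ^+ 2) - t * S + 1 / 2 * ln (N t).
pose df (t : R) : R := t / 8 * (d1 ^+ 2 + d2 ^+ 2) - S
   + ((a1 + t * d1) / N t * d1 + (a2 + t * d2) / N t * d2).
have fdf (t : R) : is_derive (t : R) (1 : R) f (df t).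
  have dN : is_derive (t : R) (1 : R) N (2 * (a1 + t * d1) * d1 + 2 * (a2 + t * d2) * d2).
    by rewrite /N; apply: is_derive_eq; rewrite /GRing.scale /=; ring.
  have dln := is_derive1_ln (N0 t).
  have dlnN : is_derive (t : R) (1 : R) (fun t => ln (N t)) _ := is_derive1_comp dln dN.
  rewrite /f; apply: is_derive_eq; rewrite /GRing.scale /= /df.
  by field; rewrite gt_eqF.
have : f 0 <= f 1.
  (* For t > 0, t [df t] is the slack of [flux_one_sided] between a and a + t d; at t = 0 the
     derivative vanishes. *)
  apply: (ge0_is_derive_ndecr R f df 0 1 fdf) => // t; rewrite le_eqVlt => /predU1P[<-|t0].
    by rewrite /df /S !mul0r !addr0 sub0r addNr.
  have := flux_one_sided R a1 a2 (a1 + t * d1) (a2 + t * d2).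
  have -> : a1 + t * d1 - a1 = t * d1 by ring.
  have -> : a2 + t * d2 - a2 = t * d2 by ring.
  have -> : 1 + (a1 ^+ 2 + a2 ^+ 2) = N 0 by rewrite /N !mul0r !addr0.
  rewrite -/(N t) => H; rewrite -(pmulr_rge0 _ t0) /df /S.
  lra.
rewrite /f /S /N !mul0r !mul1r !addr0 expr0n /= !mul0r.
have -> : a1 + d1 = b1 by rewrite /d1; ring.
have -> : a2 + d2 = b2 by rewrite /d2; ring.
lra.
Qed.

(** * Trigonometric modes *)

(** The sum telescopes, since 2 sin(t/2) cos(y) = sin(y + t/2) - sin(y - t/2). *)
Lemma sum_cos_arith (R : realType) (n : nat) (t phi : R) :
  2 * sin (t / 2) * \sum_(p < n) cos (p%:R * t + phi)
  = sin (n%:R * t + (phi - t / 2)) - sin (phi - t / 2).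
Proof.
elim: n => [|n IH]; first by rewrite big_ord0 mulr0 mul0r add0r subrr.
rewrite big_ord_recr /= mulrDr IH.
have -> : n.+1%:R * t + (phi - t / 2) = (n%:R * t + phi) + t / 2.
  by rewrite -natr1; field.
have -> : n%:R * t + (phi - t / 2) = (n%:R * t + phi) - t / 2 by ring.
set y := n%:R * t + phi; rewrite (sinD y (t / 2)) (sinB y (t / 2)); ring.
Qed.

Lemma sin_shift_periods (R : realType) (m n : nat) (x : R) :
  sin (2 * pi * (m%:R - n%:R) + x) = sin x.
Proof.
have P k y : sin (y + 2 * pi * k%:R) = sin y :> R.
  have -> : 2 * pi * k%:R = pi *+ 2 *+ k :> R.
    by rewrite -[RHS]mulr_natr -[pi *+ 2]mulr_natr [2 * pi]mulrC.
  exact: periodicn (@sinD2pi R) k y.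
by rewrite -(P n) -[RHS](P m); congr sin; ring.
Qed.

Lemma sin_pi_frac_neq0 (R : realType) (n a b : nat) :
  (a < n)%N -> (b < n)%N -> a != b -> sin (pi * (a%:R - b%:R) / n%:R) != 0 :> R.
Proof.
have H c d : (c < n)%N -> (d < c)%N -> 0 < sin (pi * (c%:R - d%:R) / n%:R) :> R.
  move=> cn dc; have n0 : 0 < n%:R :> R by rewrite ltr0n (leq_trans _ cn).
  have p0 := pi_gt0 R.
  apply: sin_gt0_pi; rewrite divr_gt0 ?mulr_gt0 ?subr_gt0 ?ltr_nat //=.
  rewrite ltr_pdivrMr // ltr_pM2l // (le_lt_trans (_ : _ <= c%:R)) ?ltr_nat //.
  by rewrite gerBl.
move=> an bn; rewrite neq_ltn => /orP[ab|ba]; last by rewrite gt_eqF // H.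
have -> : pi * (a%:R - b%:R) / n%:R = - (pi * (b%:R - a%:R) / n%:R) :> R by rewrite -[a%:R - _]opprB mulrN mulNr.
by rewrite sinN oppr_eq0 gt_eqF // H.
Qed.

(** For a <> b the angle n t is a whole number of periods, so the telescoped sum vanishes, while
    sin(t/2) does not because 0 < |a - b| < n. *)
Lemma sum_cos_ord (R : realType) (n : nat) (a b : 'I_n) (phi : R) :
  \sum_(p < n) cos (p%:R * (2 * pi * (a%:R - b%:R) / n%:R) + phi)
  = (a == b)%:R * n%:R * cos phi.
Proof.
have n0 : n%:R != 0 :> R by rewrite pnatr_eq0 -lt0n (leq_ltn_trans _ (ltn_ord a)).
have [<-|ab] := eqVneq a b.
  rewrite mul1r (eq_bigr (fun _ => cos phi)) => [|p _].
    by rewrite sumr_const card_ord mulr_natl.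
  by rewrite subrr mulr0 mul0r mulr0 add0r.
rewrite !mul0r; set t := _ / _.
have st : sin (t / 2) != 0.
  have -> : t / 2 = pi * (a%:R - b%:R) / n%:R by rewrite /t; field.
  exact: sin_pi_frac_neq0.
apply/eqP; have := sum_cos_arith R n t phi.
have -> : n%:R * t = 2 * pi * (a%:R - b%:R) by rewrite /t; field.
rewrite sin_shift_periods subrr => /eqP; rewrite mulf_eq0 mulf_eq0 (negPf st) orbF.
by rewrite pnatr_eq0.
Qed.

Lemma sum_cos_pair (R : realType) (n : nat) (a b : 'I_n * 'I_n) (phi : R) :
  \sum_(q : 'I_n * 'I_n)
    cos (q.1%:R * (2 * pi * (a.1%:R - b.1%:R) / n%:R)
       + q.2%:R * (2 * pi * (a.2%:R - b.2%:R) / n%:R) + phi)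
  = (a == b)%:R * n%:R ^+ 2 * cos phi.
Proof.
set t := _ / _; set s := _ / _.
rewrite -(pair_bigA _ (fun i j : 'I_n => cos (i%:R * t + j%:R * s + phi))) /=.
under eq_bigr => i _.
  under eq_bigr => j _ do rewrite -addrA addrCA.
  rewrite sum_cos_ord; over.
rewrite -mulr_sumr sum_cos_ord.
have -> : (a == b) = (a.1 == b.1) && (a.2 == b.2) by [].
by case: eqP; case: eqP => _ _; rewrite /= ?(mul0r, mulr0) // !mul1r mulrA.
Qed.

(** * The real discrete Fourier transform on the grid *)

Definition phase (R : realType) (K : nat) (z p : 'I_(NN K) * 'I_(NN K)) : R :=
  2 * pi * (freq R z.1 * xc R p.1 + freq R z.2 * xc R p.2).

(* The Fourier coefficient of [f] at the mode [z] is (fcos z f - i fsin z f) / N^2. *)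
Definition fcos (R : realType) (K : nat) (z : 'I_(NN K) * 'I_(NN K)) (f : grid R K) : R :=
  \sum_p f p.1 p.2 * cos (phase R K z p).
Definition fsin (R : realType) (K : nat) (z : 'I_(NN K) * 'I_(NN K)) (f : grid R K) : R :=
  \sum_p f p.1 p.2 * sin (phase R K z p).
(** [rev_ord] sends the index k to 2K - k, hence the frequency k - K to its opposite. *)
Definition neg_mode (K : nat) (z : 'I_(NN K) * 'I_(NN K)) := (rev_ord z.1, rev_ord z.2).

Lemma NN_neq0 (R : realType) (K : nat) : (NN K)%:R != 0 :> R.
Proof. by rewrite pnatr_eq0 /NN addn1. Qed.

Lemma neg_modeK (K : nat) : involutive (neg_mode K).
Proof. by case=> i j; rewrite /neg_mode !rev_ordK. Qed.

Lemma freq_rev (R : realType) (K : nat) (k : 'I_(NN K)) : freq R (rev_ord k) = - freq R k.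
Proof.
rewrite /freq /= natrB ?ltn_ord // /NN natrD natrM -natr1; ring.
Qed.

Lemma phase_neg (R : realType) (K : nat) (z p : 'I_(NN K) * 'I_(NN K)) :
  phase R K (neg_mode K z) p = - phase R K z p.
Proof. by rewrite /phase !freq_rev; ring. Qed.

(** The free shift [phi] serves both kinds of orthogonality: 0 for products of like functions, -pi/2
    for sine against cosine. *)
Lemma sum_cos_phaseB (R : realType) (K : nat) (z y : 'I_(NN K) * 'I_(NN K)) (phi : R) :
  \sum_p cos (phase R K z p - phase R K y p + phi) = (z == y)%:R * (NN K)%:R ^+ 2 * cos phi.
Proof.
rewrite -sum_cos_pair; apply: eq_bigr => p _; congr cos.
by rewrite /phase /xc /hh /freq; field; exact: NN_neq0.
Qed.

Lemma sum_cos_phaseB_dual (R : realType) (K : nat) (p q : 'I_(NN K) * 'I_(NN K)) :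
  \sum_z cos (phase R K z p - phase R K z q) = (p == q)%:R * (NN K)%:R ^+ 2.
Proof.
(* Frequencies are indices shifted by -K; [phi] collects the contribution of that shift and is 0
   when p = q. *)
pose phi : R := - K%:R * (2 * pi * (p.1%:R - q.1%:R) / (NN K)%:R + 2 * pi * (p.2%:R - q.2%:R) / (NN K)%:R).
transitivity ((p == q)%:R * (NN K)%:R ^+ 2 * cos phi); last first.
  have [E|] := eqVneq p q; last by rewrite !mul0r.
  by rewrite /phi E !subrr !mulr0 !mul0r addr0 mulr0 cos0 mulr1.
rewrite -sum_cos_pair; apply: eq_bigr => z _; congr cos.
by rewrite /phase /xc /hh /freq /phi; field; exact: NN_neq0.
Qed.

Lemma sum_cos_phaseD (R : realType) (K : nat) (z y : 'I_(NN K) * 'I_(NN K)) (phi : R) :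
  \sum_p cos (phase R K z p + phase R K y p + phi)
  = (z == neg_mode K y)%:R * (NN K)%:R ^+ 2 * cos phi.
Proof.
rewrite -sum_cos_phaseB; apply: eq_bigr => p _; congr cos.
by rewrite phase_neg opprK.
Qed.

(** Cosine does not distinguish a mode from its opposite, so both indicators appear; they coincide
    at the zero mode, where the sum doubles. *)
Lemma sum_coscos (R : realType) (K : nat) (z y : 'I_(NN K) * 'I_(NN K)) :
  \sum_p cos (phase R K y p) * cos (phase R K z p)
  = (NN K)%:R ^+ 2 / 2 * ((z == y)%:R + (z == neg_mode K y)%:R).
Proof.
have := sum_cos_phaseB R K z y 0; have := sum_cos_phaseD R K z y 0.
rewrite cos0 !mulr1 => HD HB.
have -> : (NN K)%:R ^+ 2 / 2 * ((z == y)%:R + (z == neg_mode K y)%:R)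
  = ((z == y)%:R * (NN K)%:R ^+ 2 + (z == neg_mode K y)%:R * (NN K)%:R ^+ 2) / 2 :> R by field.
rewrite -HD -HB -big_split /= mulr_suml; apply: eq_bigr => p _.
by rewrite !addr0 cosB cosD; field.
Qed.

Lemma sum_sinsin (R : realType) (K : nat) (z y : 'I_(NN K) * 'I_(NN K)) :
  \sum_p sin (phase R K y p) * sin (phase R K z p)
  = (NN K)%:R ^+ 2 / 2 * ((z == y)%:R - (z == neg_mode K y)%:R).
Proof.
have := sum_cos_phaseB R K z y 0; have := sum_cos_phaseD R K z y 0.
rewrite cos0 !mulr1 => HD HB.
have -> : (NN K)%:R ^+ 2 / 2 * ((z == y)%:R - (z == neg_mode K y)%:R)
  = ((z == y)%:R * (NN K)%:R ^+ 2 - (z == neg_mode K y)%:R * (NN K)%:R ^+ 2) / 2 :> R by field.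
rewrite -HD -HB -sumrB mulr_suml; apply: eq_bigr => p _.
by rewrite !addr0 cosB cosD; field.
Qed.

Lemma sum_sincos (R : realType) (K : nat) (z y : 'I_(NN K) * 'I_(NN K)) :
  \sum_p sin (phase R K y p) * cos (phase R K z p) = 0.
Proof.
have := sum_cos_phaseB R K z y (- (pi / 2)); have := sum_cos_phaseD R K z y (- (pi / 2)).
rewrite cosN cos_pihalf !mulr0 => HD HB.
transitivity ((\sum_p cos (phase R K z p + phase R K y p + - (pi / 2))
  - \sum_p cos (phase R K z p - phase R K y p + - (pi / 2))) / 2); last first.
  by rewrite HD HB subrr mul0r.
rewrite -sumrB mulr_suml; apply: eq_bigr => p _.
by rewrite !cosBpihalf sinB sinD; field.
Qed.

Lemma fcos_neg (R : realType) (K : nat) z (f : grid R K) :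
  fcos R K (neg_mode K z) f = fcos R K z f.
Proof. by apply: eq_bigr => p _; rewrite phase_neg cosN. Qed.

Lemma fsin_neg (R : realType) (K : nat) z (f : grid R K) :
  fsin R K (neg_mode K z) f = - fsin R K z f.
Proof. by rewrite -sumrN; apply: eq_bigr => p _; rewrite phase_neg sinN mulrN. Qed.

(** The completeness relation [sum_cos_phaseB_dual] is inserted between f at p and g at q, and cos(P
    - Q) = cos P cos Q + sin P sin Q separates the two. The factor h^4 appears because [fcos] and
    [fsin] are not normalized. *)
Lemma parseval (R : realType) (K : nat) (f g : grid R K) :
  inner f g = hh R K ^+ 4 *
    \sum_z (fcos R K z f * fcos R K z g + fsin R K z f * fsin R K z g).
Proof.
have n0 := NN_neq0 R K.
transitivity (hh R K ^+ 2 * \sum_p f p.1 p.2 * g p.1 p.2).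
  by rewrite /inner (pair_bigA _ (fun i j => f i j * g i j)).
have -> : hh R K ^+ 4 = hh R K ^+ 2 * hh R K ^+ 2 by ring.
rewrite -mulrA; congr (_ * _).
transitivity (hh R K ^+ 2 * \sum_p \sum_q f p.1 p.2 * g q.1 q.2 *
   \sum_z cos (phase R K z p - phase R K z q)).
  rewrite mulr_sumr; apply: eq_bigr => p _.
  rewrite (bigD1 p) //= [X in _ + X]big1 => [|q qp]; last first.
    by rewrite sum_cos_phaseB_dual eq_sym (negPf qp) mul0r mulr0.
  by rewrite addr0 sum_cos_phaseB_dual eqxx mul1r /hh; field.
congr (_ * _).
transitivity (\sum_p \sum_z \sum_q f p.1 p.2 * g q.1 q.2 *
   cos (phase R K z p - phase R K z q)).
  apply: eq_bigr => p _; rewrite exchange_big /=.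
  by apply: eq_bigr => q _; rewrite mulr_sumr.
rewrite exchange_big /=; apply: eq_bigr => z _.
rewrite /fcos /fsin !big_distrlr /= -big_split /=; apply: eq_bigr => p _.
rewrite -big_split /=; apply: eq_bigr => q _.
by rewrite cosB; ring.
Qed.

(** This is the real part of (a + i b)(fcos - i fsin) exp(i phase), summed over modes. *)
Lemma fmultE (R : realType) (K : nat) (a b : R -> R -> R) (f : grid R K) p :
  fmult a b f p.1 p.2 = 1 / (NN K)%:R ^+ 2 * \sum_z
   ((a (freq R z.1) (freq R z.2) * fcos R K z f + b (freq R z.1) (freq R z.2) * fsin R K z f)
      * cos (phase R K z p)
    + (a (freq R z.1) (freq R z.2) * fsin R K z f - b (freq R z.1) (freq R z.2) * fcos R K z f)
      * sin (phase R K z p)).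
Proof.
rewrite /fmult; congr (_ * _).
transitivity (\sum_q \sum_z f q.1 q.2 *
   (a (freq R z.1) (freq R z.2) * cos (phase R K z p - phase R K z q)
    - b (freq R z.1) (freq R z.2) * sin (phase R K z p - phase R K z q))).
  rewrite pair_bigA /=; apply: eq_bigr => q _; rewrite pair_bigA /= mulr_sumr.
  apply: eq_bigr => z _; congr (_ * (_ * cos _ - _ * sin _)); rewrite /phase; ring.
rewrite exchange_big /=; apply: eq_bigr => z _.
set aa := a _ _; set bb := b _ _.
rewrite /fcos /fsin mulrDl mulrBl -!mulrA.
rewrite !mulr_suml !mulr_sumr -!big_split -sumrB -big_split /=; apply: eq_bigr => q _.
by rewrite cosB sinB; ring.
Qed.

Lemma sum_delta (R : pzRingType) (I : finType) (X : I -> R) (i : I) :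
  \sum_j X j * (i == j)%:R = X i.
Proof.
rewrite (bigD1 i) //= eqxx mulr1 big1 ?addr0 // => j ji.
by rewrite eq_sym (negPf ji) mulr0.
Qed.

(** Orthogonality selects the modes z and -z with weight 1/2 each. For a Hermitian symbol the cosine
    coefficient X is even in the mode, so the halves add up to X z; the sine coefficients drop
    out. *)
Lemma fcos_fmult (R : realType) (K : nat) (a b : R -> R -> R) z (f : grid R K) :
  (forall k l, a (- k) (- l) = a k l) -> (forall k l, b (- k) (- l) = - b k l) ->
  fcos R K z (fmult a b f) =
    a (freq R z.1) (freq R z.2) * fcos R K z f + b (freq R z.1) (freq R z.2) * fsin R K z f.
Proof.
move=> ae bo; have n0 := NN_neq0 R K.
pose X y := a (freq R y.1) (freq R y.2) * fcos R K y f + b (freq R y.1) (freq R y.2) * fsin R K y f.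
pose Y y := a (freq R y.1) (freq R y.2) * fsin R K y f - b (freq R y.1) (freq R y.2) * fcos R K y f.
have Xneg y : X (neg_mode K y) = X y.
  by rewrite /X fcos_neg fsin_neg /= !freq_rev ae bo mulrNN.
transitivity (1 / (NN K)%:R ^+ 2 * \sum_y (X y * ((NN K)%:R ^+ 2 / 2 * ((z == y)%:R + (z == neg_mode K y)%:R))
    + Y y * 0)).
  rewrite /fcos; under eq_bigr => p _ do rewrite fmultE -[_ * _ * cos _]mulrA mulr_suml.
  rewrite -mulr_sumr exchange_big /=; congr (_ * _); apply: eq_bigr => y _.
  rewrite -[T in Y y * T](sum_sincos R K z y) -sum_coscos [X y * _]mulr_sumr [Y y * _]mulr_sumr -big_split /=.
  by apply: eq_bigr => p _; rewrite /X /Y; ring.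
under eq_bigr => y _ do rewrite mulr0 addr0 mulrCA mulrDr.
rewrite -mulr_sumr big_split /= sum_delta.
under [X in _ + X]eq_bigr => y _ do rewrite -(inv_eq (@neg_modeK K)).
by rewrite sum_delta Xneg -/(X z); field.
Qed.

(** Here the sine coefficient Y is odd in the mode, which compensates the minus sign in
    [sum_sinsin]. *)
Lemma fsin_fmult (R : realType) (K : nat) (a b : R -> R -> R) z (f : grid R K) :
  (forall k l, a (- k) (- l) = a k l) -> (forall k l, b (- k) (- l) = - b k l) ->
  fsin R K z (fmult a b f) =
    a (freq R z.1) (freq R z.2) * fsin R K z f - b (freq R z.1) (freq R z.2) * fcos R K z f.
Proof.
move=> ae bo; have n0 := NN_neq0 R K.
pose X y := a (freq R y.1) (freq R y.2) * fcos R K y f + b (freq R y.1) (freq R y.2) * fsin R K y f.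
pose Y y := a (freq R y.1) (freq R y.2) * fsin R K y f - b (freq R y.1) (freq R y.2) * fcos R K y f.
have Yneg y : Y (neg_mode K y) = - Y y.
  by rewrite /Y fcos_neg fsin_neg /= !freq_rev ae bo; ring.
transitivity (1 / (NN K)%:R ^+ 2 * \sum_y (X y * 0 +
    Y y * ((NN K)%:R ^+ 2 / 2 * ((z == y)%:R - (z == neg_mode K y)%:R)))).
  rewrite /fsin; under eq_bigr => p _ do rewrite fmultE -[_ * _ * sin _]mulrA mulr_suml.
  rewrite -mulr_sumr exchange_big /=; congr (_ * _); apply: eq_bigr => y _.
  rewrite -[T in X y * T](sum_sincos R K y z) -sum_sinsin [X y * _]mulr_sumr [Y y * _]mulr_sumr -big_split /=.
  by apply: eq_bigr => p _; rewrite /X /Y; ring.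
under eq_bigr => y _ do rewrite mulr0 add0r mulrCA mulrBr.
rewrite -mulr_sumr sumrB sum_delta.
under [X in _ - X]eq_bigr => y _ do rewrite -(inv_eq (@neg_modeK K)).
by rewrite sum_delta Yneg -/(Y z); field.
Qed.

(** * Action of the operators of the scheme on Fourier modes *)

Lemma lamN (R : realType) (k l : R) : lam (- k) (- l) = lam k l.
Proof. by rewrite /lam; ring. Qed.

Lemma fcos_even (R : realType) (K : nat) (a : R -> R -> R) z (f : grid R K) :
  (forall k l, a (- k) (- l) = a k l) ->
  fcos R K z (fmult a (fun _ _ => 0) f) = a (freq R z.1) (freq R z.2) * fcos R K z f.
Proof. by move=> ae; rewrite fcos_fmult // ?mul0r ?addr0 // => k l; rewrite oppr0. Qed.

Lemma fsin_even (R : realType) (K : nat) (a : R -> R -> R) z (f : grid R K) :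
  (forall k l, a (- k) (- l) = a k l) ->
  fsin R K z (fmult a (fun _ _ => 0) f) = a (freq R z.1) (freq R z.2) * fsin R K z f.
Proof. by move=> ae; rewrite fsin_fmult // ?mul0r ?subr0 // => k l; rewrite oppr0. Qed.

Lemma fcos_DNx (R : realType) (K : nat) z (f : grid R K) :
  fcos R K z (DNx f) = 2 * pi * freq R z.1 * fsin R K z f.
Proof. by rewrite /DNx fcos_fmult ?mul0r ?add0r // => k l; rewrite mulrN. Qed.

Lemma fsin_DNx (R : realType) (K : nat) z (f : grid R K) :
  fsin R K z (DNx f) = - (2 * pi * freq R z.1 * fcos R K z f).
Proof. by rewrite /DNx fsin_fmult ?mul0r ?sub0r // => k l; rewrite mulrN. Qed.

Lemma fcos_DNy (R : realType) (K : nat) z (f : grid R K) :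
  fcos R K z (DNy f) = 2 * pi * freq R z.2 * fsin R K z f.
Proof. by rewrite /DNy fcos_fmult ?mul0r ?add0r // => k l; rewrite mulrN. Qed.

Lemma fsin_DNy (R : realType) (K : nat) z (f : grid R K) :
  fsin R K z (DNy f) = - (2 * pi * freq R z.2 * fcos R K z f).
Proof. by rewrite /DNy fsin_fmult ?mul0r ?sub0r // => k l; rewrite mulrN. Qed.

Lemma fcosB (R : realType) (K : nat) z (f g : grid R K) :
  fcos R K z (fun i j => f i j - g i j) = fcos R K z f - fcos R K z g.
Proof. by rewrite /fcos -sumrB; apply: eq_bigr => p _; rewrite mulrBl. Qed.

Lemma fsinB (R : realType) (K : nat) z (f g : grid R K) :
  fsin R K z (fun i j => f i j - g i j) = fsin R K z f - fsin R K z g.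
Proof. by rewrite /fsin -sumrB; apply: eq_bigr => p _; rewrite mulrBl. Qed.

Lemma fcosDZ (R : realType) (K : nat) z (c : R) (f g : grid R K) :
  fcos R K z (fun i j => f i j + c * g i j) = fcos R K z f + c * fcos R K z g.
Proof. by rewrite /fcos mulr_sumr -big_split /=; apply: eq_bigr => p _; ring. Qed.

Lemma fsinDZ (R : realType) (K : nat) z (c : R) (f g : grid R K) :
  fsin R K z (fun i j => f i j + c * g i j) = fsin R K z f + c * fsin R K z g.
Proof. by rewrite /fsin mulr_sumr -big_split /=; apply: eq_bigr => p _; ring. Qed.

Lemma fmultB (R : realType) (K : nat) (a b : R -> R -> R) (f g : grid R K) i j :
  fmult a b (fun p q => f p q - g p q) i j = fmult a b f i j - fmult a b g i j.
Proof.
rewrite /fmult -mulrBr -sumrB; congr (_ * _); apply: eq_bigr => p _.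
by rewrite -sumrB; apply: eq_bigr => q _; rewrite mulrBl.
Qed.

Definition flux1 (R : realType) (K : nat) (u : grid R K) : grid R K :=
  fun p q => DNx u p q / (1 + (DNx u p q ^+ 2 + DNy u p q ^+ 2)).
Definition flux2 (R : realType) (K : nat) (u : grid R K) : grid R K :=
  fun p q => DNy u p q / (1 + (DNx u p q ^+ 2 + DNy u p q ^+ 2)).

Lemma fcos_fN (R : realType) (K : nat) (kappa : R) z (u : grid R K) :
  fcos R K z (fN kappa u) =
    2 * pi * freq R z.1 * fsin R K z (flux1 R K u) + 2 * pi * freq R z.2 * fsin R K z (flux2 R K u)
    - kappa * (lam (freq R z.1) (freq R z.2) * fcos R K z u).
Proof.
rewrite fcosDZ /LapN fcos_even => [|k l]; last by rewrite lamN.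
rewrite mulNr mulrN; congr (_ - _).
rewrite -fcos_DNx -fcos_DNy /fcos -big_split /=.
by apply: eq_bigr => p _; rewrite mulrDl.
Qed.

Lemma fsin_fN (R : realType) (K : nat) (kappa : R) z (u : grid R K) :
  fsin R K z (fN kappa u) =
    - (2 * pi * freq R z.1 * fcos R K z (flux1 R K u)) - 2 * pi * freq R z.2 * fcos R K z (flux2 R K u)
    - kappa * (lam (freq R z.1) (freq R z.2) * fsin R K z u).
Proof.
rewrite fsinDZ /LapN fsin_even => [|k l]; last by rewrite lamN.
rewrite mulNr mulrN; congr (_ - _).
rewrite -fsin_DNx -fsin_DNy /fsin -big_split /=.
by apply: eq_bigr => p _; rewrite mulrDl.
Qed.

(* Both [fcos z] and [fsin z] are instances of the functional [F] below. *)
Lemma scheme_mode (R : realType) (K : nat) (eps kappa dt A : R) (wt : 'I_(NN K) * 'I_(NN K) -> R)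
    (F : grid R K -> R) (z : 'I_(NN K) * 'I_(NN K)) (u1 u0 um1 um2 : grid R K) :
  (forall f, F f = \sum_p f p.1 p.2 * wt p) ->
  (forall a f, (forall k l, a (- k) (- l) = a k l) ->
     F (fmult a (fun _ _ => 0) f) = a (freq R z.1) (freq R z.2) * F f) ->
  let l := lam (freq R z.1) (freq R z.2) in
  let x := dt * Lam eps kappa (freq R z.1) (freq R z.2) in
  F (scheme_rhs eps kappa dt A u1 u0 um1 um2) =
    expR (- x) * F u0 - A * dt ^+ 3 * (g0 x * (l ^+ 2 * (F u1 - F u0)))
    - dt * (g0 x * F (fN kappa u0))
    - dt * (g1 x * (3/2 * F (fN kappa u0) - 2 * F (fN kappa um1) + 1/2 * F (fN kappa um2)))
    - dt * (g2 x * (1/2 * F (fN kappa u0) - F (fN kappa um1) + 1/2 * F (fN kappa um2))).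
Proof.
move=> FE Fmult l x.
have LamN k m : Lam eps kappa (- k) (- m) = Lam eps kappa k m by rewrite /Lam lamN.
have -> : F u1 - F u0 = F (fun p q => u1 p q - u0 p q).
  by rewrite !FE -sumrB; apply: eq_bigr => p _; rewrite mulrBl.
have -> : 3/2 * F (fN kappa u0) - 2 * F (fN kappa um1) + 1/2 * F (fN kappa um2)
   = F (fun p q => 3/2 * fN kappa u0 p q - 2 * fN kappa um1 p q + 1/2 * fN kappa um2 p q).
  by rewrite !FE !mulr_sumr -sumrB -big_split /=; apply: eq_bigr => p _; ring.
have -> : 1/2 * F (fN kappa u0) - F (fN kappa um1) + 1/2 * F (fN kappa um2)
   = F (fun p q => 1/2 * fN kappa u0 p q - fN kappa um1 p q + 1/2 * fN kappa um2 p q).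
  by rewrite !FE !mulr_sumr -sumrB -big_split /=; apply: eq_bigr => p _; ring.
set w := fun p q => _ - u0 p q; set c1 := (X in g1 x * F X); set c2 := (X in g2 x * F X).
transitivity (F (expL eps kappa dt u0) - A * dt ^+ 3 * F (phi0 eps kappa dt (LapN (LapN w)))
   - dt * F (phi0 eps kappa dt (fN kappa u0)) - dt * F (phi1 eps kappa dt c1)
   - dt * F (phi2 eps kappa dt c2)).
  by rewrite !FE !mulr_sumr -!sumrB; apply: eq_bigr => p _; rewrite /scheme_rhs -/c1 -/c2 -/w; ring.
rewrite /expL /phi0 /phi1 /phi2 !Fmult; try by move=> k m; rewrite ?LamN ?lamN.
rewrite -/x -/l; ring.
Qed.

(** * Energy estimates *)

Lemma young_mul (R : realFieldType) (r c C x p : R) : 0 <= r <= c -> 0 < C ->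
  r * (x * p) <= c / 2 * (C * x ^+ 2 + p ^+ 2 / C).
Proof.
move=> /andP[r0 rc] C0.
have q0 : 0 <= C * x ^+ 2 + p ^+ 2 / C.
  by rewrite addr_ge0 ?(mulr_ge0 (ltW C0) (sqr_ge0 _)) // divr_ge0 ?sqr_ge0 // ltW.
have xp : x * p <= (C * x ^+ 2 + p ^+ 2 / C) / 2.
  rewrite -subr_ge0.
  have -> : (C * x ^+ 2 + p ^+ 2 / C) / 2 - x * p = (C * x - p) ^+ 2 / (2 * C).
    by field; rewrite gt_eqF.
  by rewrite divr_ge0 ?sqr_ge0 // mulr_ge0 // ltW.
apply: le_trans (ler_wpM2l r0 xp) _.
by rewrite mulrA mulrAC ler_wpM2r // ler_pM2r // invr_gt0.
Qed.

(** Since exp(-x) = 1 - x g0(x), the factor L / (1 - E) is 1 / (dt g0), and dividing the scheme by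
    dt g0 leaves a rational identity. The extrapolation weights regroup as 3/2 (f0 - f1) - 1/2 (f1 -
    f2) and 1/2 (f0 - f1) - 1/2 (f1 - f2). *)
Lemma scheme_residual (R : realType) (dt A L l u1 u0 f0 f1 f2 : R) :
  0 < dt -> 0 < L ->
  u1 = expR (- (dt * L)) * u0 - A * dt ^+ 3 * (g0 (dt * L) * (l ^+ 2 * (u1 - u0)))
    - dt * (g0 (dt * L) * f0)
    - dt * (g1 (dt * L) * (3/2 * f0 - 2 * f1 + 1/2 * f2))
    - dt * (g2 (dt * L) * (1/2 * f0 - f1 + 1/2 * f2)) ->
  f0 + L * u0 = - (L / (1 - expR (- (dt * L))) + A * dt ^+ 2 * l ^+ 2) * (u1 - u0)
    - (3/2 * g1 (dt * L) + 1/2 * g2 (dt * L)) / g0 (dt * L) * (f0 - f1)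
    + (1/2 * g1 (dt * L) + 1/2 * g2 (dt * L)) / g0 (dt * L) * (f1 - f2).
Proof.
move=> dt0 L0; have x0 : 0 < dt * L by rewrite mulr_gt0.
have G0 := g0_gt0 R _ x0.
have -> : expR (- (dt * L)) = 1 - dt * L * g0 (dt * L).
  by rewrite /g0; field; rewrite !gt_eqF.
move: G0; set G := g0 _; set G1 := g1 _; set G2 := g2 _ => G0 H.
apply/eqP; rewrite -subr_eq0; apply/eqP.
transitivity ((u1 - ((1 - dt * L * G) * u0 - A * dt ^+ 3 * (G * (l ^+ 2 * (u1 - u0)))
    - dt * (G * f0) - dt * (G1 * (3/2 * f0 - 2 * f1 + 1/2 * f2))
    - dt * (G2 * (1/2 * f0 - f1 + 1/2 * f2)))) / (dt * G)); last by rewrite -H subrr mul0r.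
have -> : 1 - (1 - dt * L * G) = dt * L * G by ring.
by field; rewrite !gt_eqF.
Qed.

Lemma gam0_ge (R : realType) (kappa : R) : 0 < kappa -> 3 * (1 + kappa) <= gam0 kappa.
Proof.
move=> k0; have := C4_ge1 R; rewrite /gam0 => H.
by rewrite ler_pM2r ?addr_gt0 //; lra.
Qed.

(** This treats the cosine or sine component of a single mode: X, Y are the symbols of the two
    derivatives, and p, q the components of the successive flux increments. *)
Lemma component_energy (R : realType)
    (eps kappa dt A X Y l L u1 u0 f0 f1 f2 h1 h2 p1 p2 q1 q2 : R) :
  0 < eps -> 0 < kappa -> 0 < dt ->
  (gam0 kappa - kappa / 4) ^+ 4 * (alpha0 kappa) ^- 2 * eps ^- 2 <= A ->
  l = X ^+ 2 + Y ^+ 2 -> L = eps ^+ 2 * l ^+ 2 + kappa * l ->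
  f0 = X * h1 + Y * h2 -> f0 - f1 = X * p1 + Y * p2 -> f1 - f2 = X * q1 + Y * q2 ->
  u1 = expR (- (dt * L)) * u0 - A * dt ^+ 3 * (g0 (dt * L) * (l ^+ 2 * (u1 - u0)))
    - dt * (g0 (dt * L) * f0)
    - dt * (g1 (dt * L) * (3/2 * f0 - 2 * f1 + 1/2 * f2))
    - dt * (g2 (dt * L) * (1/2 * f0 - f1 + 1/2 * f2)) ->
  (f0 + L * u0) * (u1 - u0) + (kappa / 4 * l + eps ^+ 2 / 2 * l ^+ 2) * (u1 - u0) ^+ 2
    + (gam0 kappa - 3/2 * (1 + kappa)) * (l * (u1 - u0) ^+ 2)
  <= (1 + kappa)^-1 * (p1 ^+ 2 + p2 ^+ 2) + 1/2 * (1 + kappa)^-1 * (q1 ^+ 2 + q2 ^+ 2).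
Proof.
move=> eps0 k0 dt0 HA lE LE f0E D1 D2 Hu.
have C0 : 0 < 1 + kappa by rewrite addr_gt0.
have rhs0 : 0 <= (1 + kappa)^-1 * (p1 ^+ 2 + p2 ^+ 2) + 1/2 * (1 + kappa)^-1 * (q1 ^+ 2 + q2 ^+ 2).
  have Ci : 0 <= (1 + kappa)^-1 by rewrite invr_ge0 ltW.
  by rewrite addr_ge0 //; apply: mulr_ge0; rewrite ?addr_ge0 ?sqr_ge0 // mulr_ge0.
have l0 : 0 <= l by rewrite lE addr_ge0 ?sqr_ge0.
move: l0; rewrite le_eqVlt => /predU1P[l0|l0].
  (* At the zero mode division by dt L is impossible, but X = Y = 0 makes f0 and L vanish, so the
     left side is 0. *)
  have /andP[/eqP X0 /eqP Y0] : (X == 0) && (Y == 0).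
    move/esym/eqP: l0; rewrite lE paddr_eq0 ?sqr_ge0 //.
    by rewrite !sqrf_eq0.
  have -> : f0 = 0 by rewrite f0E X0 Y0; ring.
  have -> : L = 0 by rewrite LE -l0; ring.
  by rewrite -l0; apply: le_trans rhs0; rewrite le_eqVlt; apply/orP; left; apply/eqP; ring.
have L0 : 0 < L by rewrite LE addr_gt0 // mulr_gt0 // exprn_gt0.
have x0 : 0 < dt * L by rewrite mulr_gt0.
have G0 := g0_gt0 R _ x0.
rewrite (scheme_residual R _ _ _ _ _ _ _ _ _ dt0 L0 Hu) D1 D2.
have gk := gam0_ge R kappa k0.
have gk2 : kappa / 2 < gam0 kappa by lra.
move: (stabilized_mode_bound R eps kappa dt A _ (gam0 kappa) _ l L eps0 k0 dt0 l0 gk2 erefl erefl HA LE).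
set S := _ + A * dt ^+ 2 * l ^+ 2 => cb.
have r10 : 0 <= g1 (dt * L) / g0 (dt * L) <= 1.
  by rewrite divr_ge0 ?g1_ge0 ?(ltW G0) //= ler_pdivrMr // mul1r g1_le_g0.
have r20 : 0 <= g2 (dt * L) / g0 (dt * L) <= 1.
  by rewrite divr_ge0 ?g2_ge0 ?(ltW G0) //= ler_pdivrMr // mul1r g2_le_g0.
set r1 := (3/2 * _ + _) / _; set r2 := (1/2 * _ + _) / _.
case/andP: r10 => r10 r11; case/andP: r20 => r20 r21.
have r1b : 0 <= r1 <= 2 by rewrite /r1; apply/andP; split; lra.
have r2b : 0 <= r2 <= 1 by rewrite /r2; apply/andP; split; lra.
set w := u1 - u0.
(* With weights 2 and 1 the four inequalities cost (1 + 1/2)(1 + kappa) l w^2, which is the amount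
   subtracted from [gam0] in the statement. The signs of X w and Y w follow those of the r1 and r2
   terms in the residual. *)
have := young_mul R r1 2 (1 + kappa) (- (X * w)) p1 r1b C0.
have := young_mul R r1 2 (1 + kappa) (- (Y * w)) p2 r1b C0.
have := young_mul R r2 1 (1 + kappa) (X * w) q1 r2b C0.
have := young_mul R r2 1 (1 + kappa) (Y * w) q2 r2b C0.
have := ler_wpM2r (sqr_ge0 w) cb.
move: S r1 r2 {r1b r2b r10 r11 r20 r21 cb rhs0} => S r1 r2.
move: (1 + kappa)^-1 => Ci; rewrite lE.
lra.
Qed.

Lemma gradsqE (R : realType) (K : nat) (f : grid R K) :
  gradsq f = hh R K ^+ 4 * \sum_z lam (freq R z.1) (freq R z.2) * (fcos R K z f ^+ 2 + fsin R K z f ^+ 2).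
Proof.
rewrite /gradsq /nrm2sq !parseval -mulrDr -big_split /=; congr (_ * _).
by apply: eq_bigr => z _; rewrite fcos_DNx fsin_DNx fcos_DNy fsin_DNy /lam; ring.
Qed.

Lemma nrm2sq_LapN (R : realType) (K : nat) (f : grid R K) :
  nrm2sq (LapN f) = hh R K ^+ 4 *
    \sum_z lam (freq R z.1) (freq R z.2) ^+ 2 * (fcos R K z f ^+ 2 + fsin R K z f ^+ 2).
Proof.
rewrite /nrm2sq !parseval; congr (_ * _).
by apply: eq_bigr => z _; rewrite /LapN fcos_even ?fsin_even => [|k l|k l]; rewrite ?lamN //; ring.
Qed.

Lemma potential_increment (R : realType) (K : nat) (u1 u0 : grid R K) (c : R) :
  1/16 <= c ->
  hh R K ^+ 2 * (\sum_(i < NN K) \sum_(j < NN K) (- (1/2) * ln (1 + (DNx u1 i j ^+ 2 + DNy u1 i j ^+ 2))))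
  - hh R K ^+ 2 * (\sum_(i < NN K) \sum_(j < NN K) (- (1/2) * ln (1 + (DNx u0 i j ^+ 2 + DNy u0 i j ^+ 2))))
  <= - (inner (flux1 R K u0) (DNx (fun i j => u1 i j - u0 i j))
        + inner (flux2 R K u0) (DNy (fun i j => u1 i j - u0 i j)))
     + c * gradsq (fun i j => u1 i j - u0 i j).
Proof.
move=> cge; rewrite /gradsq /nrm2sq /inner.
rewrite -!mulrDr -mulrBr -[- (hh R K ^+ 2 * _)]mulrN [c * _]mulrCA -mulrDr ler_wpM2l ?sqr_ge0 //.
rewrite -!big_split mulr_sumr -!sumrN -!big_split ler_sum //= => i _.
rewrite -!big_split mulr_sumr -!sumrN -!big_split ler_sum //= => j _.
rewrite /DNx /DNy !fmultB -/(DNx u1) -/(DNy u1) -/(DNx u0) -/(DNy u0) -!expr2.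
apply: le_trans (log_potential_taylor R _ _ _ _) _.
by rewrite lerD2l ler_wpM2r // addr_ge0 ?sqr_ge0.
Qed.

(** The term kappa l u in L u cancels the symbol of kappa Lap inside [fN], leaving the flux and
    eps^2 Lap^2 u. The latter tested against w misses the quadratic energy increment by exactly
    (eps^2/2) |Lap w|^2, and the flux part is controlled by [potential_increment]. *)
Lemma energy_increment (R : realType) (K : nat) (eps kappa : R) (u1 u0 : grid R K) :
  1/4 <= kappa ->
  EN eps u1 - EN eps u0 <= hh R K ^+ 4 * \sum_z
    let l := lam (freq R z.1) (freq R z.2) in
    let L := Lam eps kappa (freq R z.1) (freq R z.2) in
    ((fcos R K z (fN kappa u0) + L * fcos R K z u0) * (fcos R K z u1 - fcos R K z u0)
     + (kappa / 4 * l + eps ^+ 2 / 2 * l ^+ 2) * (fcos R K z u1 - fcos R K z u0) ^+ 2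
     + ((fsin R K z (fN kappa u0) + L * fsin R K z u0) * (fsin R K z u1 - fsin R K z u0)
     + (kappa / 4 * l + eps ^+ 2 / 2 * l ^+ 2) * (fsin R K z u1 - fsin R K z u0) ^+ 2)).
Proof.
(* The lower bound on kappa makes the Taylor constant 1/16 at most kappa/4. *)
move=> k14; have c : 1/16 <= kappa / 4 by lra.
have := potential_increment R K u1 u0 _ c.
rewrite !parseval gradsqE /EN !nrm2sq_LapN.
set P1 := hh R K ^+ 2 * _; set P0 := hh R K ^+ 2 * _.
move: P1 P0 => P1 P0 H.
rewrite opprD addrACA -mulrBr -mulrBr -sumrB.
apply: le_trans (lerD H (lexx _)) _.
rewrite -mulrDr -mulrN [kappa / 4 * (_ * _)]mulrCA [eps ^+ 2 / 2 * (_ * _)]mulrCA -!mulrDr.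
rewrite ler_wpM2l //; first by rewrite exprn_ge0 // /hh divr_ge0.
rewrite -big_split -sumrN /= !mulr_sumr -!big_split /=.
apply: ler_sum => z _.
rewrite fcos_DNx fsin_DNx fcos_DNy fsin_DNy fcos_fN fsin_fN fcosB fsinB /Lam.
by rewrite le_eqVlt; apply/orP; left; apply/eqP; field.
Qed.

Lemma shifted_flux_lipschitz (R : realFieldType) (kappa a1 a2 b1 b2 : R) : 0 <= kappa ->
  (b1 / (1 + (b1 ^+ 2 + b2 ^+ 2)) + kappa * b1 - (a1 / (1 + (a1 ^+ 2 + a2 ^+ 2)) + kappa * a1)) ^+ 2
  + (b2 / (1 + (b1 ^+ 2 + b2 ^+ 2)) + kappa * b2 - (a2 / (1 + (a1 ^+ 2 + a2 ^+ 2)) + kappa * a2)) ^+ 2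
  <= (1 + kappa) ^+ 2 * ((b1 - a1) ^+ 2 + (b2 - a2) ^+ 2).
Proof.
move=> k0; have := flux_lipschitz R a1 a2 b1 b2.
set A := 1 + (a1 ^+ 2 + _); set B := 1 + (b1 ^+ 2 + _).
have -> : b1 / B + kappa * b1 - (a1 / A + kappa * a1) = (b1 / B - a1 / A) + kappa * (b1 - a1) by ring.
have -> : b2 / B + kappa * b2 - (a2 / A + kappa * a2) = (b2 / B - a2 / A) + kappa * (b2 - a2) by ring.
move: (b1 / B - _) (b2 / B - _) (b1 - a1) (b2 - a2) => e1 e2 d1 d2 H.
(* For |e| <= |d|, the slack (1 + kappa)^2 |d|^2 - |e + kappa d|^2 equals |d|^2 - |e|^2 plus this
   quantity. *)
have : 0 <= kappa * ((d1 ^+ 2 + d2 ^+ 2 - (e1 ^+ 2 + e2 ^+ 2)) + ((d1 - e1) ^+ 2 + (d2 - e2) ^+ 2)).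
  by rewrite mulr_ge0 // addr_ge0 ?subr_ge0 // addr_ge0 ?sqr_ge0.
lra.
Qed.

Definition sflux1 (R : realType) (K : nat) (kappa : R) (u : grid R K) : grid R K :=
  fun p q => flux1 R K u p q + kappa * DNx u p q.
Definition sflux2 (R : realType) (K : nat) (kappa : R) (u : grid R K) : grid R K :=
  fun p q => flux2 R K u p q + kappa * DNy u p q.

(** Absorbing kappa grad u into the flux exhibits all of [fN] as a divergence. The factors are
    written as in [lam], so that X^2 + Y^2 is [lam] by conversion. *)
Lemma fcos_fN_sflux (R : realType) (K : nat) (kappa : R) z (u : grid R K) :
  fcos R K z (fN kappa u) = 2 * freq R z.1 * pi * fsin R K z (sflux1 R K kappa u)
    + 2 * freq R z.2 * pi * fsin R K z (sflux2 R K kappa u).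
Proof. by rewrite fcos_fN !fsinDZ fsin_DNx fsin_DNy /lam; ring. Qed.

Lemma fsin_fN_sflux (R : realType) (K : nat) (kappa : R) z (u : grid R K) :
  fsin R K z (fN kappa u) = 2 * freq R z.1 * pi * - fcos R K z (sflux1 R K kappa u)
    + 2 * freq R z.2 * pi * - fcos R K z (sflux2 R K kappa u).
Proof. by rewrite fsin_fN !fcosDZ fcos_DNx fcos_DNy /lam; ring. Qed.

(** Parseval turns the sum over modes into a sum over grid points, where the pointwise Lipschitz
    bound applies. *)
Lemma sflux_lipschitz (R : realType) (K : nat) (kappa : R) (u v : grid R K) : 0 <= kappa ->
  hh R K ^+ 4 * (\sum_z
    ((fsin R K z (sflux1 R K kappa u) - fsin R K z (sflux1 R K kappa v)) ^+ 2
   + (fsin R K z (sflux2 R K kappa u) - fsin R K z (sflux2 R K kappa v)) ^+ 2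
   + ((fcos R K z (sflux1 R K kappa u) - fcos R K z (sflux1 R K kappa v)) ^+ 2
   + (fcos R K z (sflux2 R K kappa u) - fcos R K z (sflux2 R K kappa v)) ^+ 2)))
  <= (1 + kappa) ^+ 2 * gradsq (fun i j => u i j - v i j).
Proof.
move=> k0.
apply: le_trans (_ : nrm2sq (fun i j => sflux1 R K kappa u i j - sflux1 R K kappa v i j)
  + nrm2sq (fun i j => sflux2 R K kappa u i j - sflux2 R K kappa v i j) <= _).
  rewrite /nrm2sq !parseval -mulrDr -big_split /= le_eqVlt; apply/orP; left; apply/eqP.
  by congr (_ * _); apply: eq_bigr => z _; rewrite !fcosB !fsinB; ring.
rewrite /gradsq /nrm2sq /inner -!mulrDr mulrCA ler_wpM2l ?sqr_ge0 //.
rewrite -!big_split mulr_sumr ler_sum //= => i _.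
rewrite -!big_split mulr_sumr ler_sum //= => j _.
rewrite /DNx /DNy !fmultB -/(DNx u) -/(DNy u) -/(DNx v) -/(DNy v) -!expr2.
exact: shifted_flux_lipschitz.
Qed.

Lemma gradsq_ge0 (R : realType) (K : nat) (f : grid R K) : 0 <= gradsq f.
Proof.
rewrite gradsqE mulr_ge0 ?exprn_ge0 ?divr_ge0 // sumr_ge0 // => z _.
by apply: mulr_ge0; rewrite /lam addr_ge0 // sqr_ge0.
Qed.

Theorem theorem2p1 (R : realType) (K : nat) (eps kappa dt A : R)
  (u : int -> grid R K) :
  0 < eps -> 1/4 <= kappa -> 0 < dt ->
  (gam0 kappa - kappa / 4) ^+ 4 * (alpha0 kappa) ^- 2 * eps ^- 2 <= A ->
  mean (u (-2)%Z) = mean (u (-1)%Z) ->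
  mean (u (-1)%Z) = mean (u 0%Z) ->
  (forall n : nat,
     u (n%:Z + 1)%Z =
       scheme_rhs eps kappa dt A (u (n%:Z + 1)%Z) (u n%:Z) (u (n%:Z - 1)%Z) (u (n%:Z - 2)%Z)) ->
  forall n : nat,
    Etilde eps kappa (u (n%:Z + 1)%Z) (u n%:Z) (u (n%:Z - 1)%Z)
    <= Etilde eps kappa (u n%:Z) (u (n%:Z - 1)%Z) (u (n%:Z - 2)%Z).
Proof.
move=> eps0 k14 dt0 HA _ _ Hu n.
have k0 : 0 < kappa by lra.
have C0 : 0 < 1 + kappa by lra.
move: (u (n%:Z + 1)%Z) (u n%:Z) (u (n%:Z - 1)%Z) (u (n%:Z - 2)%Z) (Hu n) => u1 u0 um1 um2 {}Hu.
set gr0 := gradsq (fun i j => u1 i j - u0 i j).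
set gr1 := gradsq (fun i j => u0 i j - um1 i j).
set gr2 := gradsq (fun i j => um1 i j - um2 i j).
have main : EN eps u1 - EN eps u0 + (gam0 kappa - 3/2 * (1 + kappa)) * gr0
    <= (1 + kappa) * gr1 + 1/2 * (1 + kappa) * gr2.
  apply: le_trans (lerD (energy_increment R K eps kappa u1 u0 k14) (lexx _)) _.
  have L1 := sflux_lipschitz R K kappa u0 um1 (ltW k0).
  have L2 := sflux_lipschitz R K kappa um1 um2 (ltW k0).
  (* The weights are rewritten so that the Lipschitz bounds, which carry (1 + kappa)^2, replace the
     gradients by mode sums of flux increments; the claim then follows mode by mode. *)
  have -> : (1 + kappa) * gr1 + 1/2 * (1 + kappa) * gr2
     = (1 + kappa)^-1 * ((1 + kappa) ^+ 2 * gr1) + 1/2 * (1 + kappa)^-1 * ((1 + kappa) ^+ 2 * gr2).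
    by field; rewrite gt_eqF.
  have Ci : 0 < (1 + kappa)^-1 by rewrite invr_gt0.
  have Ci2 : 0 <= 1/2 * (1 + kappa)^-1 by lra.
  apply: le_trans (lerD (ler_wpM2l (ltW Ci) L1) (ler_wpM2l Ci2 L2)).
  rewrite /gr0 gradsqE [(gam0 kappa - _) * _]mulrCA -mulrDr [(1 + kappa)^-1 * _]mulrCA.
  rewrite [1/2 * _ * _]mulrCA -mulrDr ler_wpM2l //; first by rewrite exprn_ge0 // /hh divr_ge0.
  rewrite !mulr_sumr -!big_split ler_sum //= => z _.
  have HC := scheme_mode R K eps kappa dt A (fun p => cos (phase R K z p)) (fcos R K z) z
    u1 u0 um1 um2 (fun f => erefl) (fun a f => fcos_even R K a z f).
  have HS := scheme_mode R K eps kappa dt A (fun p => sin (phase R K z p)) (fsin R K z) z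
    u1 u0 um1 um2 (fun f => erefl) (fun a f => fsin_even R K a z f).
  rewrite -Hu in HC; rewrite -Hu in HS.
  have DC v w : fcos R K z (fN kappa v) - fcos R K z (fN kappa w)
    = 2 * freq R z.1 * pi * (fsin R K z (sflux1 R K kappa v) - fsin R K z (sflux1 R K kappa w))
    + 2 * freq R z.2 * pi * (fsin R K z (sflux2 R K kappa v) - fsin R K z (sflux2 R K kappa w)).
    by rewrite !fcos_fN_sflux; ring.
  have DS v w : fsin R K z (fN kappa v) - fsin R K z (fN kappa w)
    = 2 * freq R z.1 * pi * - (fcos R K z (sflux1 R K kappa v) - fcos R K z (sflux1 R K kappa w))
    + 2 * freq R z.2 * pi * - (fcos R K z (sflux2 R K kappa v) - fcos R K z (sflux2 R K kappa w)).
    by rewrite !fsin_fN_sflux; ring.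
  have EC := component_energy R eps kappa dt A _ _ _ _ _ _ _ _ _ _ _ _ _ _ _ eps0 k0 dt0 HA
    erefl erefl (fcos_fN_sflux R K kappa z u0) (DC u0 um1) (DC um1 um2) HC.
  have ES := component_energy R eps kappa dt A _ _ _ _ _ _ _ _ _ _ _ _ _ _ _ eps0 k0 dt0 HA
    erefl erefl (fsin_fN_sflux R K kappa z u0) (DS u0 um1) (DS um1 um2) HS.
  rewrite !fcosB !fsinB; move: (lerD EC ES); rewrite !sqrrN.
  rewrite -/(lam (freq R z.1) (freq R z.2)) -/(Lam eps kappa (freq R z.1) (freq R z.2)).
  lra.
(* Here gam1 - gam3 = C4 (1 + kappa) and gam3 is half of it, so [main] differs from the claim only
   by nonnegative multiples of (C4 - 1)(1 + kappa) times squared gradients. *)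
have C41 := C4_ge1 R.
have CC0 : 0 <= (C4 R - 1) * (1 + kappa) by rewrite mulr_ge0 // ?subr_ge0 // ltW.
have D0 := mulr_ge0 CC0 (gradsq_ge0 R K (fun i j => u1 i j - u0 i j)).
have D1 := mulr_ge0 CC0 (gradsq_ge0 R K (fun i j => u0 i j - um1 i j)).
have D2 := mulr_ge0 CC0 (gradsq_ge0 R K (fun i j => um1 i j - um2 i j)).
rewrite -/gr0 in D0; rewrite -/gr1 in D1; rewrite -/gr2 in D2.
rewrite /Etilde -/gr0 -/gr1 -/gr2 /gam1 /gam3.
move: main; rewrite /gam0.
lra.
Qed.
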